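(* Let $\mathbf{A}=(A,\rhd,+,-)$ be an irack and let $\mathbf{TRel}_{\mathbf{A}}$ be the braided strict monoidal category of tangled relations over $\mathbf{A}$. Then the relations $$\eta:I\to A\times A,\quad ()\sim(a,a^-)\ (a\in A),\qquad \varepsilon:A\times A\to I,\quad (a,a^+)\sim()\ (a\in A)$$ furnish the object $A$ with a tangle algebra structure in $\mathbf{TRel}_{\mathbf{A}}$.
   Context: An irack $\mathbf{A}=(A,\rhd,+,-)$ is a set $A$ with unary operations $a\mapsto a^+$, $a\mapsto a^-$ and a binary operation $\rhd$ such that for all $a,b,c\in A$: (1) $(a^+)^-=a=(a^-)^+$; (2) $a\rhd a^-=a^+$; (3) $a^-\rhd(a\rhd b)=b$; (4) $a\rhd(a^-\rhd b)=b$; (5) $a\rhd(b\rhd c)=(a\rhd b)\rhd(a\rhd c)$; (6) $a\rhd b^-=(a\rhd b)^-$. For a tuple $\mathbf{a}=(a_1,\dots,a_n)\in A^n$ and $b\in A$, $\mathbf{a}\rhd b=a_1\rhd(a_2\rhd(\cdots(a_n\rhd b)\cdots))$, with $\mathbf{a}\rhd b=b$ if $n=0$; for a tuple $\mathbf{b}=(b_1,\dots,b_m)$, $\mathbf{a}\rhd\mathbf{b}=(\mathbf{a}\rhd b_1,\dots,\mathbf{a}\rhd b_m)$. The category $\mathbf{TRel}_{\mathbf{A}}$ has as objects the formal powers $A^m$ ($m\ge0$), with $I=A^0$, and as arrows $A^m\to A^n$ the relations $R$ from $A^m$ to $A^n$ such that whenever $\mathbf{a}\,R\,\mathbf{b}$,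 then for every $c\in A$: (TR1) $(c\rhd\mathbf{a})\,R\,(c\rhd\mathbf{b})$, and (TR2) $\mathbf{a}\rhd c=\mathbf{b}\rhd c$. Composition is composition of relations; the strict monoidal structure is given by cartesian product of sets and of relations; the braiding is given by the functions $\tau_{m,n}:A^m\times A^n\to A^n\times A^m$, $(\mathbf{a},\mathbf{b})\mapsto(\mathbf{a}\rhd\mathbf{b},\mathbf{a})$. A tangle algebra structure on an object $X$ of a braided strict monoidal category with braiding $\tau$ consists of arrows $\eta:I\to X\otimes X$ and $\varepsilon:X\otimes X\to I$ such that (self-duality) $(\varepsilon\otimes 1_X)(1_X\otimes\eta)=1_X=(1_X\otimes\varepsilon)(\eta\otimes 1_X)$ and (commutativity) $\varepsilon\,\tau_{X,X}=\varepsilon$ and $\tau_{X,X}\,\eta=\eta$. Composites are written right to left. *)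

(* Defs.v *)
From mathcomp Require Import all_boot.
From mathcomp Require Import boolp.
Set Implicit Arguments.
Unset Strict Implicit.
Unset Printing Implicit Defensive.

(* Transport of an arrow along equalities of objects: strictness of a monoidal
   structure is equality of objects, so the two sides of an equation between
   arrows may live in different, propositionally equal, hom-types. *)
Definition castH (ob : Type) (hom : ob -> ob -> Type) (X X' Y Y' : ob)
    (eX : X = X') (eY : Y = Y') (f : hom X Y) : hom X' Y' :=
  match eX in _ = Z, eY in _ = W return hom Z W with
  | erefl, erefl => f
  end.

(* [comp g f] is "g after f". *)
Record category := Category {
  ob :> Type;
  hom : ob -> ob -> Type;
  idh : forall X, hom X X;
  comp : forall X Y Z, hom Y Z -> hom X Y -> hom X Z;
  comp_idl : forall X Y (f : hom X Y), comp (idh Y) f = f;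
  comp_idr : forall X Y (f : hom X Y), comp f (idh X) = f;
  compA : forall X Y Z W (h : hom Z W) (g : hom Y Z) (f : hom X Y),
    comp h (comp g f) = comp (comp h g) f
}.

Arguments idh {c} X.

Record strictMonoidal := StrictMonoidal {
  smcat :> category;
  I : smcat;
  tens : smcat -> smcat -> smcat;
  tensh : forall X X' Y Y' : smcat,
    hom X X' -> hom Y Y' -> hom (tens X Y) (tens X' Y');
  tensh_id : forall X Y : smcat, tensh (idh X) (idh Y) = idh (tens X Y);
  tensh_comp : forall (X X' X'' Y Y' Y'' : smcat)
      (f : hom X X') (f' : hom X' X'') (g : hom Y Y') (g' : hom Y' Y''),
    tensh (comp f' f) (comp g' g) = comp (tensh f' g') (tensh f g);
  tensA : forall X Y Z : smcat, tens X (tens Y Z) = tens (tens X Y) Z;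
  tens1l : forall X : smcat, tens I X = X;
  tens1r : forall X : smcat, tens X I = X;
  tenshA : forall (X X' Y Y' Z Z' : smcat)
      (f : hom X X') (g : hom Y Y') (h : hom Z Z'),
    castH (tensA X Y Z) (tensA X' Y' Z') (tensh f (tensh g h))
      = tensh (tensh f g) h;
  tensh1l : forall (X X' : smcat) (f : hom X X'),
    castH (tens1l X) (tens1l X') (tensh (idh I) f) = f;
  tensh1r : forall (X X' : smcat) (f : hom X X'),
    castH (tens1r X) (tens1r X') (tensh f (idh I)) = f
}.

Arguments I {s}.

Record braidedStrictMonoidal := BraidedStrictMonoidal {
  bsmcat :> strictMonoidal;
  braid : forall X Y : bsmcat, hom (tens X Y) (tens Y X);
  braid_nat : forall (X X' Y Y' : bsmcat) (f : hom X X') (g : hom Y Y'),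
    comp (braid X' Y') (tensh f g) = comp (tensh g f) (braid X Y);
  braid_iso : forall X Y : bsmcat,
    exists g : hom (tens Y X) (tens X Y),
      comp g (braid X Y) = idh (tens X Y) /\
      comp (braid X Y) g = idh (tens Y X);
  braid_tensr : forall X Y Z : bsmcat,
    braid X (tens Y Z)
      = comp (castH (tensA Y X Z) (tensA Y Z X) (tensh (idh Y) (braid X Z)))
             (castH (esym (tensA X Y Z)) erefl (tensh (braid X Y) (idh Z)));
  braid_tensl : forall X Y Z : bsmcat,
    braid (tens X Y) Z
      = comp (castH erefl (esym (tensA Z X Y)) (tensh (braid X Z) (idh Y)))
             (castH (tensA X Y Z) (tensA X Z Y) (tensh (idh X) (braid Y Z)))
}.

Record is_tangle_algebra (C : braidedStrictMonoidal) (X : C)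
    (eta : hom I (tens X X)) (eps : hom (tens X X) I) : Prop := {
  self_dual_l :
    comp (castH erefl (tens1l X) (tensh eps (idh X)))
         (castH (tens1r X) (tensA X X X) (tensh (idh X) eta)) = idh X;
  self_dual_r :
    comp (castH erefl (tens1r X) (tensh (idh X) eps))
         (castH (tens1l X) (esym (tensA X X X)) (tensh eta (idh X))) = idh X;
  eps_comm : comp eps (braid X X) = eps;
  eta_comm : comp (braid X X) eta = eta
}.

Record irack := Irack {
  carrier :> Type;
  iop : carrier -> carrier -> carrier;
  ipls : carrier -> carrier;
  imns : carrier -> carrier;
  iplsK : forall a, imns (ipls a) = a;
  imnsK : forall a, ipls (imns a) = a;
  iop_imns : forall a, iop a (imns a) = ipls a;
  iopK : forall a b, iop (imns a) (iop a b) = b;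
  iopVK : forall a b, iop a (iop (imns a) b) = b;
  iopD : forall a b c, iop a (iop b c) = iop (iop a b) (iop a c);
  iopN : forall a b, iop a (imns b) = imns (iop a b)
}.

Section Action.
Variable A : irack.
Implicit Types (a b c : A) (s t u : seq A).

(* a |> b for a tuple (here any sequence) a and an element b *)
Definition act s b : A := foldr (@iop A) b s.

Lemma act_cat s t b : act (s ++ t) b = act s (act t b).
Proof. exact: foldr_cat. Qed.

Lemma iop_act c s b : iop c (act s b) = act (map (iop c) s) (iop c b).
Proof. by elim: s => //= a s IH; rewrite iopD IH. Qed.

Lemma act_iop s b c : act s (iop b c) = iop (act s b) (act s c).
Proof. by elim: s => //= a s IH; rewrite IH iopD. Qed.

Lemma act_act s t c : act s (act t c) = act (map (act s) t) (act s c).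
Proof. by elim: t => //= a t IH; rewrite act_iop IH. Qed.

Definition actV s : seq A := rev (map (@imns A) s).

Lemma actK s : cancel (act s) (act (actV s)).
Proof.
elim: s => //= a s IH b.
by rewrite /actV map_cons rev_cons -cats1 act_cat /= iopK IH.
Qed.

Lemma actVK s : cancel (act (actV s)) (act s).
Proof.
elim: s => //= a s IH b.
by rewrite /actV map_cons rev_cons -cats1 act_cat /= IH iopVK.
Qed.

End Action.

Section TRel.
Variable A : irack.
Implicit Types (m n p q : nat) (s t u : seq A).

Record tangled m n (R : m.-tuple A -> n.-tuple A -> Prop) : Prop := Tangled {
  TR1 : forall a b, R a b ->
    forall c : A, R (map_tuple (iop c) a) (map_tuple (iop c) b);
  TR2 : forall a b, R a b -> forall c : A, act a c = act b c
}.

Definition trel m n := {R : m.-tuple A -> n.-tuple A -> Prop | tangled R}.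

Definition id_rel m (a b : m.-tuple A) : Prop := a = b.

Definition comp_rel m n p (S : n.-tuple A -> p.-tuple A -> Prop)
    (R : m.-tuple A -> n.-tuple A -> Prop) a c : Prop :=
  exists b, R a b /\ S b c.

Definition tens_rel m m' n n' (R : m.-tuple A -> m'.-tuple A -> Prop)
    (S : n.-tuple A -> n'.-tuple A -> Prop)
    (x : (m + n).-tuple A) (y : (m' + n').-tuple A) : Prop :=
  exists a b a' b', [/\ x = cat_tuple a b, y = cat_tuple a' b', R a a' & S b b'].

Definition braid_rel m n (x : (m + n).-tuple A) (y : (n + m).-tuple A) : Prop :=
  exists a b, x = cat_tuple a b /\ y = cat_tuple (map_tuple (act a) b) a.

Definition conv_rel m n (R : m.-tuple A -> n.-tuple A -> Prop) b a : Prop := R a b.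

Lemma map_cat_tuple (f : A -> A) m n (a : m.-tuple A) (b : n.-tuple A) :
  map_tuple f (cat_tuple a b) = cat_tuple (map_tuple f a) (map_tuple f b).
Proof. by apply: val_inj; rewrite /= map_cat. Qed.

Lemma id_tangled m : tangled (@id_rel m).
Proof. by split=> a b ->. Qed.

Lemma comp_tangled m n p (S : n.-tuple A -> p.-tuple A -> Prop)
    (R : m.-tuple A -> n.-tuple A -> Prop) :
  tangled S -> tangled R -> tangled (comp_rel S R).
Proof.
move=> [S1 S2] [R1 R2]; split=> a c [b [Rab Sbc]] d.
  by exists (map_tuple (iop d) b); split; [apply: R1 | apply: S1].
by rewrite (R2 _ _ Rab) (S2 _ _ Sbc).
Qed.

Lemma tens_tangled m m' n n' (R : m.-tuple A -> m'.-tuple A -> Prop)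
    (S : n.-tuple A -> n'.-tuple A -> Prop) :
  tangled R -> tangled S -> tangled (tens_rel R S).
Proof.
move=> [R1 R2] [S1 S2]; split=> _ _ [a [b [a' [b' [-> -> Ra Sb]]]]] c.
  exists (map_tuple (iop c) a), (map_tuple (iop c) b).
  exists (map_tuple (iop c) a'), (map_tuple (iop c) b').
  by rewrite !map_cat_tuple; split=> //; [apply: R1 | apply: S1].
by rewrite /= !act_cat (S2 _ _ Sb) (R2 _ _ Ra).
Qed.

Lemma braid_tangled m n : tangled (@braid_rel m n).
Proof.
split=> _ _ [a [b [-> ->]]] c; last by rewrite /= !act_cat act_act.
exists (map_tuple (iop c) a), (map_tuple (iop c) b).
rewrite !map_cat_tuple; split=> //; congr cat_tuple; apply: val_inj => /=.
by rewrite -!map_comp; apply: eq_map => x /=; rewrite iop_act.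
Qed.

Lemma conv_tangled m n (R : m.-tuple A -> n.-tuple A -> Prop) :
  tangled R -> tangled (conv_rel R).
Proof.
move=> [R1 R2]; split=> a b Rba c; first exact: R1.
by rewrite (R2 _ _ Rba).
Qed.

Definition trel_id m : trel m m := exist _ _ (id_tangled m).
Definition trel_comp m n p (S : trel n p) (R : trel m n) : trel m p :=
  exist _ _ (comp_tangled (svalP S) (svalP R)).
Definition trel_tens m m' n n' (R : trel m m') (S : trel n n') :
    trel (m + n) (m' + n') :=
  exist _ _ (tens_tangled (svalP R) (svalP S)).
Definition trel_braid m n : trel (m + n) (n + m) :=
  exist _ _ (@braid_tangled m n).
Definition trel_conv m n (R : trel m n) : trel n m :=
  exist _ _ (conv_tangled (svalP R)).

(* The same arrow as a relation between sequences: its type does not mention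
   the arities, so that casts disappear from it. *)
Definition lrel m n (R : trel m n) s t : Prop :=
  exists (a : m.-tuple A) (b : n.-tuple A), [/\ s = a, t = b & sval R a b].

Lemma lrelE m n (R : trel m n) a b : lrel R (val a) (val b) <-> sval R a b.
Proof.
split; last by exists a, b.
by move=> [a' [b' [/val_inj-> /val_inj-> Rab]]].
Qed.

Lemma trel_eq m n (R S : trel m n) :
  (forall s t, lrel R s t <-> lrel S s t) -> R = S.
Proof.
move=> E; have: sval R = sval S.
  by apply/funext => a; apply/funext => b; apply/propext; rewrite -!lrelE.
case: R S {E} => [R HR] [S HS] /= E.
by case: S / E HS => HS; congr exist; apply: Prop_irrelevance.
Qed.

Lemma lrel_size m n (R : trel m n) s t : lrel R s t -> size s = m /\ size t = n.
Proof. by move=> [a [b [-> -> _]]]; rewrite !size_tuple. Qed.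

Lemma lrel_TR2 m n (R : trel m n) s t c : lrel R s t -> act s c = act t c.
Proof. by move=> [a [b [-> -> /(TR2 (svalP R))]]]. Qed.

Lemma lrel_TR1 m n (R : trel m n) u s t :
  lrel R s t -> lrel R (map (act u) s) (map (act u) t).
Proof.
move=> Rst; elim: u => [|c u]; first by rewrite !map_id.
move=> [a [b [Ea Eb /(TR1 (svalP R))/(_ c) Rab]]].
exists (map_tuple (iop c) a), (map_tuple (iop c) b); split=> //=.
  by rewrite -Ea -map_comp.
by rewrite -Eb -map_comp.
Qed.

Lemma lrel_castP m m' n n' (em : m = m') (en : n = n') (R : trel m n) s t :
  lrel (castH em en R) s t <-> lrel R s t.
Proof. by case: m' / em; case: n' / en. Qed.

Lemma lrel_idP m s t : lrel (trel_id m) s t <-> size s = m /\ s = t.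
Proof.
split=> [[a [b [-> -> ->]]]|[sz <-]]; first by rewrite size_tuple.
by case: m / sz; exists (in_tuple s), (in_tuple s).
Qed.

Lemma lrel_compP m n p (S : trel n p) (R : trel m n) s t :
  lrel (trel_comp S R) s t <-> exists u, lrel R s u /\ lrel S u t.
Proof.
split=> [[a [c [-> -> [b [Rab Sbc]]]]]|[u [[a [b [-> -> Rab]]]]]].
  by exists b; split; [exists a, b | exists b, c].
move=> [b' [c [/val_inj <- -> Sbc]]].
by exists a, c; split=> //; exists b.
Qed.

Lemma lrel_tensP m m' n n' (R : trel m m') (S : trel n n') s t :
  lrel (trel_tens R S) s t <->
  exists s1 s2 t1 t2, [/\ s = s1 ++ s2, t = t1 ++ t2, lrel R s1 t1 & lrel S s2 t2].
Proof.
split.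
  move=> [_ [_ [-> -> [a [b [a' [b' [-> -> Ra Sb]]]]]]]].
  by exists a, b, a', b'; split=> //; [exists a, a' | exists b, b'].
move=> [_ [_ [_ [_ [-> -> [a [a' [-> -> Ra]]] [b [b' [-> -> Sb]]]]]]]].
by exists (cat_tuple a b), (cat_tuple a' b'); split=> //; exists a, b, a', b'.
Qed.

Lemma lrel_braidP m n s t :
  lrel (trel_braid m n) s t <->
  exists s1 s2, [/\ size s1 = m, size s2 = n, s = s1 ++ s2 &
                    t = map (act s1) s2 ++ s1].
Proof.
split.
  by move=> [_ [_ [-> -> [a [b [-> ->]]]]]]; exists a, b; rewrite !size_tuple.
move=> [s1 [s2 [Em En -> ->]]]; case: m / Em; case: n / En.
exists (cat_tuple (in_tuple s1) (in_tuple s2)).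
exists (cat_tuple (map_tuple (act s1) (in_tuple s2)) (in_tuple s1)).
by split=> //; exists (in_tuple s1), (in_tuple s2).
Qed.

Lemma lrel_convP m n (R : trel m n) s t : lrel (trel_conv R) s t <-> lrel R t s.
Proof. by split=> -[a [b [-> -> Rab]]]; exists b, a. Qed.

Definition lrel_castE m m' n n' em en R s t :=
  propext (@lrel_castP m m' n n' em en R s t).
Definition lrel_idE m s t := propext (lrel_idP m s t).
Definition lrel_compE m n p S R s t := propext (@lrel_compP m n p S R s t).
Definition lrel_tensE m m' n n' R S s t := propext (@lrel_tensP m m' n n' R S s t).
Definition lrel_braidE m n s t := propext (lrel_braidP m n s t).
Definition lrel_convE m n R s t := propext (@lrel_convP m n R s t).

Lemma trel_comp_idl m n (R : trel m n) : trel_comp (trel_id n) R = R.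
Proof.
apply: trel_eq => s t; rewrite lrel_compE; split.
  by move=> [u [Rsu /lrel_idP[_ <-]]].
by move=> Rst; exists t; rewrite lrel_idE; have [] := lrel_size Rst.
Qed.

Lemma trel_comp_idr m n (R : trel m n) : trel_comp R (trel_id m) = R.
Proof.
apply: trel_eq => s t; rewrite lrel_compE; split.
  by move=> [u [/lrel_idP[_ <-]]].
by move=> Rst; exists s; rewrite lrel_idE; have [] := lrel_size Rst.
Qed.

Lemma trel_compA m n p q (T : trel p q) (S : trel n p) (R : trel m n) :
  trel_comp T (trel_comp S R) = trel_comp (trel_comp T S) R.
Proof.
apply: trel_eq => s t; rewrite !lrel_compE; split.
  move=> [v [/lrel_compP[u [? ?]] ?]]; exists u; rewrite lrel_compE.
  by split=> //; exists v.
move=> [u [? /lrel_compP[v [? ?]]]]; exists v; rewrite lrel_compE.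
by split=> //; exists u.
Qed.

Lemma trel_tens_id m n : trel_tens (trel_id m) (trel_id n) = trel_id (m + n).
Proof.
apply: trel_eq => s t; rewrite lrel_tensE lrel_idE; split.
  move=> [s1 [s2 [_ [_ [-> -> /lrel_idP[<- <-] /lrel_idP[<- <-]]]]]].
  by rewrite size_cat.
move=> [sz <-]; exists (take m s), (drop m s), (take m s), (drop m s).
rewrite cat_take_drop !lrel_idE size_drop size_takel sz ?leq_addr //.
by rewrite addnC addnK.
Qed.

Lemma cat_inj (T : Type) (s1 s2 t1 t2 : seq T) :
  size s1 = size t1 -> s1 ++ s2 = t1 ++ t2 -> s1 = t1 /\ s2 = t2.
Proof.
elim: s1 t1 => [|x s1 IH] [|y t1] //= [sz] [<- E].
by have [<- <-] := IH _ sz E.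
Qed.

Lemma trel_tens_comp m m' m'' n n' n''
    (R : trel m m') (R' : trel m' m'') (S : trel n n') (S' : trel n' n'') :
  trel_tens (trel_comp R' R) (trel_comp S' S)
    = trel_comp (trel_tens R' S') (trel_tens R S).
Proof.
apply: trel_eq => s t; rewrite lrel_tensE lrel_compE; split.
  move=> [s1 [s2 [t1 [t2 [-> ->]]]]].
  move=> /lrel_compP[u1 [R1 R2]] /lrel_compP[u2 [S1 S2]].
  exists (u1 ++ u2); rewrite !lrel_tensE; split.
    by exists s1, s2, u1, u2.
  by exists u1, u2, t1, t2.
move=> [u [/lrel_tensP[s1 [s2 [u1 [u2 [-> -> R1 S1]]]]]]].
move=> /lrel_tensP[v1 [v2 [t1 [t2 [E -> R2 S2]]]]].
have [_ sz1] := lrel_size R1; have [sz2 _] := lrel_size R2.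
have [|E1 E2] := cat_inj _ E; first by rewrite sz1.
subst v1 v2; exists s1, s2, t1, t2; rewrite !lrel_compE.
by split=> //; [exists u1 | exists u2].
Qed.

Lemma trel_tensA m m' n n' p p' (R : trel m m') (S : trel n n') (T : trel p p') :
  castH (addnA m n p) (addnA m' n' p') (trel_tens R (trel_tens S T))
    = trel_tens (trel_tens R S) T.
Proof.
apply: trel_eq => s t; rewrite lrel_castE !lrel_tensE; split.
  move=> [s1 [_ [t1 [_ [-> -> ? /lrel_tensP[s2 [s3 [t2 [t3 [-> -> ? ?]]]]]]]]]].
  exists (s1 ++ s2), s3, (t1 ++ t2), t3; rewrite !catA lrel_tensE.
  by split=> //; exists s1, s2, t1, t2.
move=> [_ [s3 [_ [t3 [-> -> /lrel_tensP[s1 [s2 [t1 [t2 [-> -> ? ?]]]]]]]]]] ?.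
exists s1, (s2 ++ s3), t1, (t2 ++ t3); rewrite -!catA lrel_tensE.
by split=> //; exists s2, s3, t2, t3.
Qed.

Lemma trel_tens1l m n (R : trel m n) :
  castH (add0n m) (add0n n) (trel_tens (trel_id 0) R) = R.
Proof.
apply: trel_eq => s t; rewrite lrel_castE lrel_tensE; split.
  by move=> [s1 [s2 [t1 [t2 [-> -> /lrel_idP[/size0nil-> <-]]]]]].
by move=> Rst; exists [::], s, [::], t; rewrite lrel_idE.
Qed.

Lemma trel_tens1r m n (R : trel m n) :
  castH (addn0 m) (addn0 n) (trel_tens R (trel_id 0)) = R.
Proof.
apply: trel_eq => s t; rewrite lrel_castE lrel_tensE; split.
  move=> [s1 [s2 [t1 [t2 [-> -> R1 /lrel_idP[/size0nil-> <-]]]]]].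
  by rewrite !cats0.
by move=> Rst; exists s, [::], t, [::]; rewrite lrel_idE !cats0.
Qed.

Lemma trel_braid_nat m m' n n' (R : trel m m') (S : trel n n') :
  trel_comp (trel_braid m' n') (trel_tens R S)
    = trel_comp (trel_tens S R) (trel_braid m n).
Proof.
apply: trel_eq => s t; rewrite !lrel_compE; split.
  move=> [_ [/lrel_tensP[a [b [a' [b' [-> -> Ra Sb]]]]]]].
  move=> /lrel_braidP[x [y [szx szy E ->]]].
  have [szR szR'] := lrel_size Ra; have [szS szS'] := lrel_size Sb.
  have [|? ?] := cat_inj _ E; first by rewrite szx.
  subst x y; exists (map (act a) b ++ a); rewrite lrel_braidE lrel_tensE.
  split; first by exists a, b.
  exists (map (act a) b), a, (map (act a') b'), a'; split=> //.
  suff -> : map (act a') b' = map (act a) b' by apply: lrel_TR1.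
  by apply: eq_map => c; rewrite (lrel_TR2 _ Ra).
move=> [_ [/lrel_braidP[a [b [sza szb -> ->]]]]].
move=> /lrel_tensP[x [y [b' [a' [E -> Sx Ra]]]]].
have [szS szS'] := lrel_size Sx; have [szR szR'] := lrel_size Ra.
have [|? ?] := cat_inj _ E; first by rewrite size_map szb.
subst x y; have := lrel_TR1 (actV a) Sx.
rewrite -map_comp (eq_map (@actK _ a)) map_id => Sb.
exists (a' ++ map (act (actV a)) b'); rewrite lrel_tensE lrel_braidE; split.
  by exists a, b, a', (map (act (actV a)) b').
exists a', (map (act (actV a)) b'); split=> //; first by rewrite size_map.
congr cat; rewrite -map_comp -[LHS]map_id; apply: eq_map => c /=.
by rewrite -(lrel_TR2 _ Ra) actVK.
Qed.

Lemma trel_braid_iso m n :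
  exists R : trel (n + m) (m + n),
    trel_comp R (trel_braid m n) = trel_id (m + n) /\
    trel_comp (trel_braid m n) R = trel_id (n + m).
Proof.
exists (trel_conv (trel_braid m n)); split; apply: trel_eq => s t;
  rewrite lrel_compE lrel_idE; split.
- move=> [_ [/lrel_braidP[a [b [sza szb -> ->]]]]].
  rewrite lrel_convE lrel_braidE => -[a' [b' [sza' szb' -> E]]].
  have [|E1 E2] := cat_inj _ E; first by rewrite !size_map szb.
  subst a'; rewrite size_cat sza szb; split=> //; congr cat.
  exact: inj_map (can_inj (@actK _ a)) _ _ E1.
- move=> [sz <-]; exists (map (act (take m s)) (drop m s) ++ take m s).
  rewrite lrel_convE.
  suff H : lrel (trel_braid m n) s
             (map (act (take m s)) (drop m s) ++ take m s) by [].
  rewrite lrel_braidE; exists (take m s), (drop m s).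
  by rewrite cat_take_drop size_drop size_takel sz ?leq_addr // addnC addnK.
- move=> [u [/lrel_convP/lrel_braidP[a [b [sza szb -> ->]]]]].
  move=> /lrel_braidP[a' [b' [sza' szb' E ->]]].
  have [|E1 E2] := cat_inj _ E; first by rewrite sza.
  by subst a' b'; rewrite size_cat size_map sza szb.
move=> [sz <-]; pose a := drop n s; pose b := map (act (actV a)) (take n s).
exists (a ++ b); rewrite lrel_convE.
suff H : lrel (trel_braid m n) (a ++ b) s by [].
rewrite lrel_braidE; exists a, b.
rewrite size_map size_drop size_takel sz ?leq_addr // addnC addnK.
split=> //; rewrite -map_comp (eq_map (@actVK _ a)) map_id.
by rewrite cat_take_drop.
Qed.

Lemma trel_braid_tensr m n p :
  trel_braid m (n + p)
    = trel_comp
        (castH (addnA n m p) (addnA n p m) (trel_tens (trel_id n) (trel_braid m p)))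
        (castH (esym (addnA m n p)) erefl (trel_tens (trel_braid m n) (trel_id p))).
Proof.
apply: trel_eq => s t; rewrite lrel_compE lrel_braidE; split.
  move=> [a [x [sza szx -> ->]]].
  pose b := take n x; pose c := drop n x.
  have szb : size b = n by rewrite size_takel // szx leq_addr.
  have szc : size c = p by rewrite size_drop szx addnC addnK.
  rewrite -(cat_take_drop n x) -/b -/c map_cat.
  exists (map (act a) b ++ a ++ c); rewrite !lrel_castE !lrel_tensE; split.
    exists (a ++ b), c, (map (act a) b ++ a), c.
    by rewrite !catA lrel_braidE lrel_idE; split=> //; exists a, b.
  exists (map (act a) b), (a ++ c), (map (act a) b), (map (act a) c ++ a).
  rewrite -!catA lrel_braidE lrel_idE size_map.
  by split=> //; exists a, c.
move=> [u [/lrel_castP/lrel_tensP[w1 [c [w2 [w3 [-> ->]]]]]]].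
move=> /lrel_braidP[a [b [sza szb -> ->]]] /lrel_idP[szc <-].
move=> /lrel_castP/lrel_tensP[b' [v1 [v2 [v3 [E ->]]]]] /lrel_idP[szb' <-].
move=> /lrel_braidP[a' [c' [sza' szc' E' ->]]].
move: E; rewrite E' -catA => E.
have [|E1 {}E] := cat_inj _ E; first by rewrite size_map szb.
have [|E2 E3] := cat_inj _ E; first by rewrite sza.
subst a' c' b'; exists a, (b ++ c).
by rewrite size_cat szb szc map_cat -!catA.
Qed.

Lemma trel_braid_tensl m n p :
  trel_braid (m + n) p
    = trel_comp
        (castH erefl (esym (addnA p m n)) (trel_tens (trel_braid m p) (trel_id n)))
        (castH (addnA m n p) (addnA m p n) (trel_tens (trel_id m) (trel_braid n p))).
Proof.
apply: trel_eq => s t; rewrite lrel_compE lrel_braidE; split.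
  move=> [x [c [szx szc -> ->]]].
  pose a := take m x; pose b := drop m x.
  have sza : size a = m by rewrite size_takel // szx leq_addr.
  have szb : size b = n by rewrite size_drop szx addnC addnK.
  have Ex : x = a ++ b by rewrite cat_take_drop.
  exists (a ++ map (act b) c ++ b); rewrite !lrel_castE !lrel_tensE; split.
    exists a, (b ++ c), a, (map (act b) c ++ b).
    by rewrite Ex -!catA lrel_braidE lrel_idE; split=> //; exists b, c.
  exists (a ++ map (act b) c), b, (map (act a) (map (act b) c) ++ a), b.
  rewrite !catA lrel_braidE lrel_idE; split=> //; last first.
    by exists a, (map (act b) c); rewrite size_map.
  rewrite -catA -Ex -map_comp; congr cat; apply: eq_map => d /=.
  by rewrite Ex act_cat.
move=> [u [/lrel_castP/lrel_tensP[a [w1 [w2 [w3 [-> ->]]]]]]] /lrel_idP[sza <-].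
move=> /lrel_braidP[b [c [szb szc -> ->]]].
move=> /lrel_castP/lrel_tensP[v1 [b' [v2 [v3 [E ->]]]]].
move=> /lrel_braidP[a' [c' [sza' szc' E' ->]]] /lrel_idP[szb' <-].
move: E; rewrite E' -catA => E.
have [|E1 {}E] := cat_inj _ E; first by rewrite sza.
have [|E2 E3] := cat_inj _ E; first by rewrite size_map szc.
subst a' c' b'; exists (a ++ b), c.
rewrite size_cat sza szb -!catA -map_comp; split=> //.
by congr cat; apply: eq_map => d /=; rewrite act_cat.
Qed.

(* The object n stands for the formal power A^n. *)
Definition TRel_cat : category :=
  Category trel_comp_idl trel_comp_idr trel_compA.

Definition TRel_sm : strictMonoidal :=
  @StrictMonoidal TRel_cat 0 addn trel_tens trel_tens_id trel_tens_comp
    addnA add0n addn0 trel_tensA trel_tens1l trel_tens1r.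

Definition TRel : braidedStrictMonoidal :=
  @BraidedStrictMonoidal TRel_sm trel_braid trel_braid_nat trel_braid_iso
    trel_braid_tensr trel_braid_tensl.

Definition eta_rel (x : 0.-tuple A) (y : (1 + 1).-tuple A) : Prop :=
  exists a : A, y = [tuple a; imns a].

Definition eps_rel (x : (1 + 1).-tuple A) (y : 0.-tuple A) : Prop :=
  exists a : A, x = [tuple a; ipls a].

End TRel.

(* Main.v *)
Require Import Defs.
From mathcomp Require Import all_boot.

(** Since $a^-$ and $a^+$ both act inversely to $a$, the pairs $(a,a^-)$ and $(a,a^+)$ act as the
    identity, which is (TR2); (TR1) holds because $c\rhd{-}$ commutes with $-$ and $+$. Self-duality
    only uses that $-$ and $+$ are mutually inverse. Commutativity rests on how the braiding moves
    the pairs: $(a,a^-)\mapsto(a^+,a)$ by axiom (2), and $(a,a^+)\mapsto(a^-,a)$ by its dual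
    [iop_ipls]. *)

Section IrackTheory.
Variable A : irack.
Implicit Types a b c : A.

Lemma iop_inj c : injective (iop c).
Proof. exact: can_inj (iopK c). Qed.

Lemma ipls_inj : injective (@ipls A).
Proof. exact: can_inj (@iplsK A). Qed.

Lemma iopP a b : iop a (ipls b) = ipls (iop a b).
Proof. by rewrite -[LHS]imnsK -iopN iplsK. Qed.

Lemma iplsVK a b : iop a (iop (ipls a) b) = b.
Proof. by have := iopK (ipls a) b; rewrite iplsK. Qed.

(* Axiom (2) at [a^+] reads [a^+ |> a = a^++]; now apply [a |> _], which is
   inverse to [a^+ |> _]. *)
Lemma iop_ipls2 a : iop a (ipls (ipls a)) = a.
Proof. by rewrite -iop_imns iplsK iplsVK. Qed.

(** After applying the injective $+$ and moving it inside the action, this becomes $a\rhd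
    a^{++}=a$. *)
Lemma iop_ipls a : iop a (ipls a) = imns a.
Proof. by apply: ipls_inj; rewrite -iopP iop_ipls2 imnsK. Qed.

End IrackTheory.

Section TangleAlgebra.
Variable A : irack.

Lemma eta_tangled : tangled (@eta_rel A).
Proof.
split=> x y [a ->] c; last by rewrite (tuple0 x) /= iopVK.
by exists (iop c a); apply: val_inj; rewrite /= iopN.
Qed.

Lemma eps_tangled : tangled (@eps_rel A).
Proof.
split=> x y [a ->] c; last by rewrite (tuple0 y) /= iplsVK.
by exists (iop c a); apply: val_inj; rewrite /= iopP.
Qed.

Definition eta : trel A 0 (1 + 1) := exist _ _ eta_tangled.
Definition eps : trel A (1 + 1) 0 := exist _ _ eps_tangled.

Lemma lrel_etaP s t :
  lrel eta s t <-> s = [::] /\ exists a : A, t = [:: a; imns a].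
Proof.
split=> [[x [y [-> -> [a ->]]]]|[-> [a ->]]].
  by rewrite (tuple0 x); split=> //; exists a.
by exists [tuple], [tuple a; imns a]; split=> //; exists a.
Qed.

Lemma lrel_epsP s t :
  lrel eps s t <-> t = [::] /\ exists a : A, s = [:: a; ipls a].
Proof.
split=> [[x [y [-> -> [a ->]]]]|[-> [a ->]]].
  by rewrite (tuple0 y); split=> //; exists a.
by exists [tuple a; ipls a], [tuple]; split=> //; exists a.
Qed.

Lemma lrel_id1P s t : lrel (trel_id A 1) s t <-> exists x, s = [:: x] /\ t = [:: x].
Proof.
rewrite lrel_idE; split=> [[]|[x [-> ->]]] //.
by case: s => [|x []] // _ <-; exists x.
Qed.

Lemma lrel_braid11P s t :
  lrel (trel_braid A 1 1) s t <->
  exists a b, s = [:: a; b] /\ t = [:: iop a b; a].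
Proof.
rewrite lrel_braidE; split=> [[s1 [s2 []]]|[a [b [-> ->]]]].
  by case: s1 => [|a []] // _; case: s2 => [|b []] // _ -> ->; exists a, b.
by exists [:: a], [:: b].
Qed.

(** From $x$, [eta] produces $(x,a,a^-)$; [eps] accepts $(x,a)$ only if $a=x^+$, leaving $a^-=x$. *)
Lemma eta_eps_self_dual_l :
  trel_comp
    (castH erefl (add0n 1) (trel_tens eps (trel_id A 1)))
    (castH (addn0 1) (addnA 1 1 1) (trel_tens (trel_id A 1) eta))
  = trel_id A 1.
Proof.
apply: trel_eq => s t; rewrite lrel_compE; split.
  move=> [u [/lrel_castP/lrel_tensP[s1 [s2 [u1 [u2 [-> ->]]]]]]].
  move=> /lrel_id1P[x [-> ->]] /lrel_etaP[-> [a ->]].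
  move=> /lrel_castP/lrel_tensP[v1 [v2 [t1 [t2 [E ->]]]]].
  move=> /lrel_epsP[-> [b Ev1]] /lrel_id1P[y [Ev2 ->]].
  move: E; rewrite Ev1 Ev2 => -[-> -> <-].
  by apply/lrel_id1P; exists b; rewrite iplsK.
move=> /lrel_id1P[x [-> ->]]; exists [:: x; ipls x; x].
rewrite !lrel_castE !lrel_tensE; split.
  exists [:: x], [::], [:: x], [:: ipls x; x].
  split=> //; first by apply/lrel_id1P; exists x.
  by apply/lrel_etaP; split=> //; exists (ipls x); rewrite iplsK.
exists [:: x; ipls x], [:: x], [::], [:: x].
split=> //; last by apply/lrel_id1P; exists x.
by apply/lrel_epsP; split=> //; exists x.
Qed.

(** Here the middle tuple is $(a,a^-,x)$, and [eps] forces $x=(a^-)^+=a$. *)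
Lemma eta_eps_self_dual_r :
  trel_comp
    (castH erefl (addn0 1) (trel_tens (trel_id A 1) eps))
    (castH (add0n 1) (esym (addnA 1 1 1)) (trel_tens eta (trel_id A 1)))
  = trel_id A 1.
Proof.
apply: trel_eq => s t; rewrite lrel_compE; split.
  move=> [u [/lrel_castP/lrel_tensP[s1 [s2 [u1 [u2 [-> ->]]]]]]].
  move=> /lrel_etaP[-> [a ->]] /lrel_id1P[x [-> ->]].
  move=> /lrel_castP/lrel_tensP[v1 [v2 [t1 [t2 [E ->]]]]].
  move=> /lrel_id1P[y [Ev1 ->]] /lrel_epsP[-> [b Ev2]].
  move: E; rewrite Ev1 Ev2 => -[-> <- ->].
  by apply/lrel_id1P; exists y; rewrite imnsK.
move=> /lrel_id1P[x [-> ->]]; exists [:: x; imns x; x].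
rewrite !lrel_castE !lrel_tensE; split.
  exists [::], [:: x], [:: x; imns x], [:: x].
  split=> //; last by apply/lrel_id1P; exists x.
  by apply/lrel_etaP; split=> //; exists x.
exists [:: x], [:: imns x; x], [:: x], [::].
split=> //; first by apply/lrel_id1P; exists x.
by apply/lrel_epsP; split=> //; exists (imns x); rewrite imnsK.
Qed.

Lemma eps_braid : trel_comp eps (trel_braid A 1 1) = eps.
Proof.
apply: trel_eq => s t; rewrite lrel_compE; split.
  move=> [_ [/lrel_braid11P[a [b [-> ->]]] /lrel_epsP[-> [c [E Ea]]]]].
  apply/lrel_epsP; split=> //; exists a; congr [:: _; _].
  (* To get $b=a^+$, compare both sides under $a\rhd({-})^+$: they become $(a\rhd b)^+=c^+=a$ and
     $a\rhd a^{++}=a$. *)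
  apply: ipls_inj; apply: (@iop_inj _ a).
  by rewrite iopP E -Ea iop_ipls2.
move=> /lrel_epsP[-> [a ->]]; exists [:: imns a; a].
rewrite lrel_epsP; split.
  by apply/lrel_braid11P; exists a, (ipls a); rewrite iop_ipls.
by split=> //; exists (imns a); rewrite imnsK.
Qed.

Lemma braid_eta : trel_comp (trel_braid A 1 1) eta = eta.
Proof.
apply: trel_eq => s t; rewrite lrel_compE; split.
  move=> [_ [/lrel_etaP[-> [a ->]] /lrel_braid11P[_ [_ [[<- <-] ->]]]]].
  by apply/lrel_etaP; split=> //; exists (ipls a); rewrite iop_imns iplsK.
(* The preimage of $(a,a^-)$ under the braiding is the [eta] pair of $a^-$, as $a^-\rhd
   a^{--}=a^{-+}=a$. *)
move=> /lrel_etaP[-> [a ->]]; exists [:: imns a; imns (imns a)].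
rewrite lrel_etaP; split; first by split=> //; exists (imns a).
by apply/lrel_braid11P; exists (imns a), (imns (imns a)); rewrite iop_imns imnsK.
Qed.

End TangleAlgebra.

Theorem proposition3p2 (A : irack) :
  exists (eta_tangled : tangled (@eta_rel A)) (eps_tangled : tangled (@eps_rel A)),
    @is_tangle_algebra (TRel A) 1
      (exist _ (@eta_rel A) eta_tangled) (exist _ (@eps_rel A) eps_tangled).
Proof.
exists (eta_tangled A), (eps_tangled A); split.
(* The operations of [TRel A] unfold to those on [trel], so each law matches its lemma by
   conversion. *)
- exact: eta_eps_self_dual_l.
- exact: eta_eps_self_dual_r.
- exact: eps_braid.
- exact: braid_eta.
Qed.
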